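(* Let $\mathbb{C}$ be a path category and let $f\colon A\to I$ and $g\colon B\to A$ be two fibrations in $\mathbb{C}$. Then every homotopy weak dependent product of $f$ and $g$ is a homotopy full diagram over $f,g$. (Here a homotopy weak dependent product $u\colon U\to I$, $e\colon U\times_IA\to B$ is regarded as a diagram over $f,g$ via the pullback projections $U\times_IA\to U$ and $U\times_IA\to A$.)
   Context: Path category (van den Berg–Moerdijk): a category with a terminal object and two classes of arrows, weak equivalences and fibrations, closed under isomorphism and composition, such that: weak equivalences satisfy 2-out-of-6; every arrow to the terminal object is a fibration; pullbacks along fibrations exist, and fibrations and acyclic fibrations (fibrations that are weak equivalences) are stable under pullback; every acyclic fibration has a section; every object $X$ has a path object, i.e. a factorisation of the diagonal $X\to X\times X$ as a weak equivalence $X\to PX$ followed by a fibration $PX\to X\times X$. Consequently every fibration $g\colon B\to A$ has a fibrewise path object: a factorisation of $B\to B\times_AB$ as a weak equivalence $B\to P_gB$ followed by a fibration $P_gB\to B\times_AB$. Homotopy. Arrows $d,d'\colon C\to X$ are homotopic, $d\simeq d'$, if $\langle d,d'\rangle$ factors through $PX\to X\times X$. If $g\colon B\to A$ is a fibration and $d,d'\colon C\to B$ satisfy $gd=gd'$, then $d\simeq_g d'$ means that $\langle d,d'\rangle\colon C\to B\times_AB$ factors through $P_gB\to B\times_AB$. Homotopy pullback. A square $V\xrightarrow{p_1}U\xrightarrow{u}I$, $V\xrightarrow{p_2}A\xrightarrow{f}I$ commuting up to homotopy is a homotopy pullback if, for some homotopy $V\to PI$ from $up_1$ to $fp_2$,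 the induced arrow $V\to U\times_IPI\times_IA$ is a weak equivalence. Homotopy weak dependent product. Let $g\colon B\to A$ and $f\colon A\to I$ be fibrations. A homotopy weak dependent product of $f$ and $g$ consists of a fibration $u\colon U\to I$ and an arrow $e\colon U\times_IA\to B$ such that $ge$ is the projection $U\times_IA\to A$, and such that for every fibration $u'\colon U'\to I$ and arrow $e'\colon U'\times_IA\to B$ with $ge'$ equal to the projection $U'\times_IA\to A$, there is $k\colon U'\to U$ with $uk=u'$ and $e\circ(k\times A)\simeq_g e'$, where $k\times A\colon U'\times_IA\to U\times_IA$ is the induced arrow. Homotopy full diagram. Let $f\colon A\to I$ and $g\colon B\to A$ be arrows. Consider diagrams over $f,g$ consisting of objects $U,V$ and arrows $u\colon U\to I$, $p_1\colon V\to U$, $p_2\colon V\to A$, $e\colon V\to B$ with $ge\simeq p_2$, $up_1\simeq fp_2$ and such that this latter square is a homotopy pullback. Such a diagram is homotopy full over $f,g$ if for every such diagram $(U',V',u',p_1',p_2',e')$ over $f,g$ there are an arrow $h\colon U'\to U$, a homotopy pullback $V\xleftarrow{q}P\xrightarrow{r}U'$ of $V\xrightarrow{p_1}U\xleftarrow{h}U'$ and an arrow $k\colon P\to V'$ such that $uh\simeq u'$, $p_1'k\simeq r$, $p_2'k\simeq p_2q$ and $e'k\simeq eq$. *)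

(* Defs.v *)
Set Implicit Arguments.
Unset Strict Implicit.
Unset Printing Implicit Defensive.

(** Limits, path objects and induced arrows are not chosen: they are described by
    their universal properties, up to Leibniz equality of arrows. *)

Record category := Category {
  ob :> Type;
  hom : ob -> ob -> Type;
  idm : forall X, hom X X;
  comp : forall X Y Z, hom Y Z -> hom X Y -> hom X Z;
  comp_idl : forall X Y (f : hom X Y), comp (idm Y) f = f;
  comp_idr : forall X Y (f : hom X Y), comp f (idm X) = f;
  comp_assoc : forall X Y Z W (h : hom Z W) (g : hom Y Z) (f : hom X Y),
    comp h (comp g f) = comp (comp h g) f
}.

Arguments idm {_} _.

Notation "X ~> Y" := (hom X Y) (at level 90, no associativity).
Notation "g ∘ f" := (comp g f) (at level 40, left associativity).

Section Category.
Variable C : category.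

Definition is_iso (X Y : C) (f : X ~> Y) : Prop :=
  exists f' : Y ~> X, f' ∘ f = idm X /\ f ∘ f' = idm Y.

Definition is_terminal (T : C) : Prop :=
  forall X : C, exists! _ : X ~> T, True.

Definition is_product (X Y P : C) (p1 : P ~> X) (p2 : P ~> Y) : Prop :=
  forall (Q : C) (a : Q ~> X) (b : Q ~> Y),
    exists! m : Q ~> P, p1 ∘ m = a /\ p2 ∘ m = b.

Definition is_pullback (X Y Z P : C) (f : X ~> Z) (g : Y ~> Z)
    (p1 : P ~> X) (p2 : P ~> Y) : Prop :=
  f ∘ p1 = g ∘ p2 /\
  forall (Q : C) (a : Q ~> X) (b : Q ~> Y), f ∘ a = g ∘ b ->
    exists! m : Q ~> P, p1 ∘ m = a /\ p2 ∘ m = b.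

Definition arrow_class := forall X Y : C, (X ~> Y) -> Prop.

(** Closure under isomorphism in the arrow category. *)
Definition iso_closed (K : arrow_class) : Prop :=
  forall (X Y X' Y' : C) (f : X ~> Y) (f' : X' ~> Y') (i : X ~> X') (j : Y ~> Y'),
    is_iso i -> is_iso j -> j ∘ f = f' ∘ i -> K X Y f -> K X' Y' f'.

Definition comp_closed (K : arrow_class) : Prop :=
  forall (X Y Z : C) (g : Y ~> Z) (f : X ~> Y), K Y Z g -> K X Y f -> K X Z (g ∘ f).

Definition two_out_of_six (K : arrow_class) : Prop :=
  forall (X Y Z W : C) (f : X ~> Y) (g : Y ~> Z) (h : Z ~> W),
    K X Z (g ∘ f) -> K Y W (h ∘ g) ->
    K X Y f /\ K Y Z g /\ K Z W h /\ K X W (h ∘ g ∘ f).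

Definition pullback_stable (K : arrow_class) : Prop :=
  forall (X Y Z P : C) (f : X ~> Z) (g : Y ~> Z) (p1 : P ~> X) (p2 : P ~> Y),
    is_pullback f g p1 p2 -> K X Z f -> K P Y p2.

End Category.

Record wf_category := WfCategory {
  wf_cat :> category;
  weq : arrow_class wf_cat;
  fib : arrow_class wf_cat
}.

Arguments weq {_} {_ _} _.
Arguments fib {_} {_ _} _.

Section PathObjects.
Variable C : wf_category.

Definition afib (X Y : C) (f : X ~> Y) : Prop := fib f /\ weq f.

(** When [k1, k2 : K ~> X] exhibit [K] as [X × X] (or [X ×_A X]): [p ∘ r] is a
    factorisation of the diagonal as a weak equivalence followed by a fibration. *)
Definition diagonal_factorisation (X K P : C) (k1 k2 : K ~> X)
    (r : X ~> P) (p : P ~> K) : Prop :=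
  weq r /\ fib p /\ k1 ∘ (p ∘ r) = idm X /\ k2 ∘ (p ∘ r) = idm X.

(** [s] and [t] are the two components of the fibration [P ~> X × X]. *)
Definition is_path_object (X P : C) (s t : P ~> X) : Prop :=
  exists (K : C) (k1 k2 : K ~> X) (r : X ~> P) (p : P ~> K),
    is_product k1 k2 /\ diagonal_factorisation k1 k2 r p /\
    k1 ∘ p = s /\ k2 ∘ p = t.

Definition is_fibrewise_path_object (A B : C) (g : B ~> A) (P : C) (s t : P ~> B) : Prop :=
  exists (K : C) (k1 k2 : K ~> B) (r : B ~> P) (p : P ~> K),
    is_pullback g g k1 k2 /\ diagonal_factorisation k1 k2 r p /\
    k1 ∘ p = s /\ k2 ∘ p = t.

(** [⟨d, d'⟩] factors through [⟨s, t⟩] via [H]. *)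
Definition is_homotopy (X P D : C) (s t : P ~> X) (H : D ~> P) (d d' : D ~> X) : Prop :=
  s ∘ H = d /\ t ∘ H = d'.

Definition homotopic (D X : C) (d d' : D ~> X) : Prop :=
  exists (P : C) (s t : P ~> X) (H : D ~> P),
    is_path_object s t /\ is_homotopy s t H d d'.

(** The equation [g ∘ d = g ∘ d'] follows, since [g ∘ s = g ∘ t]. *)
Definition fibrewise_homotopic (A B : C) (g : B ~> A) (D : C) (d d' : D ~> B) : Prop :=
  exists (P : C) (s t : P ~> B) (H : D ~> P),
    is_fibrewise_path_object g s t /\ is_homotopy s t H d d'.

End PathObjects.

Record path_category := PathCategory {
  pc_wf :> wf_category;
  weq_iso : iso_closed (@weq pc_wf);
  weq_comp : comp_closed (@weq pc_wf);
  fib_iso : iso_closed (@fib pc_wf);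
  fib_comp : comp_closed (@fib pc_wf);
  has_terminal : exists T : pc_wf, is_terminal T;
  weq_2of6 : two_out_of_six (@weq pc_wf);
  fib_terminal : forall (X T : pc_wf) (f : X ~> T), is_terminal T -> fib f;
  has_pullback : forall (X Y Z : pc_wf) (f : X ~> Z) (g : Y ~> Z), fib f ->
    exists (P : pc_wf) (p1 : P ~> X) (p2 : P ~> Y), is_pullback f g p1 p2;
  fib_pullback : pullback_stable (@fib pc_wf);
  afib_pullback : pullback_stable (@afib pc_wf);
  afib_section : forall (X Y : pc_wf) (f : X ~> Y), afib f ->
    exists s : Y ~> X, f ∘ s = idm Y;
  has_path_object : forall X : pc_wf,
    exists (P : pc_wf) (s t : P ~> X), is_path_object s t
}.

Section HomotopyFull.
Variable C : path_category.

(** [Q] is [U ×_I PI] and [W] is [U ×_I PI ×_I A]; [m] is the arrow induced by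
    [p1], the homotopy [H] and [p2]. *)
Definition is_homotopy_pullback (U A I V : C) (u : U ~> I) (f : A ~> I)
    (p1 : V ~> U) (p2 : V ~> A) : Prop :=
  exists (PI : C) (s t : PI ~> I) (H : V ~> PI),
    is_path_object s t /\ is_homotopy s t H (u ∘ p1) (f ∘ p2) /\
    exists (Q : C) (q1 : Q ~> U) (q2 : Q ~> PI)
           (W : C) (w1 : W ~> Q) (w2 : W ~> A) (m : V ~> W),
      is_pullback u s q1 q2 /\ is_pullback (t ∘ q2) f w1 w2 /\
      q1 ∘ w1 ∘ m = p1 /\ q2 ∘ w1 ∘ m = H /\ w2 ∘ m = p2 /\
      weq m.

(** [V] is [U ×_I A] with projections [p1] and [p2], and [kA] is [k × A]. *)
Definition is_homotopy_weak_dependent_product (A I B : C) (f : A ~> I) (g : B ~> A)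
    (U V : C) (u : U ~> I) (p1 : V ~> U) (p2 : V ~> A) (e : V ~> B) : Prop :=
  fib u /\ is_pullback u f p1 p2 /\ g ∘ e = p2 /\
  forall (U' V' : C) (u' : U' ~> I) (p1' : V' ~> U') (p2' : V' ~> A) (e' : V' ~> B),
    fib u' -> is_pullback u' f p1' p2' -> g ∘ e' = p2' ->
    exists (k : U' ~> U) (kA : V' ~> V),
      u ∘ k = u' /\ p1 ∘ kA = k ∘ p1' /\ p2 ∘ kA = p2' /\
      fibrewise_homotopic g (e ∘ kA) e'.

Definition is_diagram_over (A I B : C) (f : A ~> I) (g : B ~> A)
    (U V : C) (u : U ~> I) (p1 : V ~> U) (p2 : V ~> A) (e : V ~> B) : Prop :=
  homotopic (g ∘ e) p2 /\ homotopic (u ∘ p1) (f ∘ p2) /\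
  is_homotopy_pullback u f p1 p2.

Definition is_homotopy_full (A I B : C) (f : A ~> I) (g : B ~> A)
    (U V : C) (u : U ~> I) (p1 : V ~> U) (p2 : V ~> A) (e : V ~> B) : Prop :=
  is_diagram_over f g u p1 p2 e /\
  forall (U' V' : C) (u' : U' ~> I) (p1' : V' ~> U') (p2' : V' ~> A) (e' : V' ~> B),
    is_diagram_over f g u' p1' p2' e' ->
    exists (h : U' ~> U) (P : C) (q : P ~> V) (r : P ~> U') (k : P ~> V'),
      is_homotopy_pullback p1 h q r /\
      homotopic (u ∘ h) u' /\ homotopic (p1' ∘ k) r /\
      homotopic (p2' ∘ k) (p2 ∘ q) /\ homotopic (e' ∘ k) (e ∘ q).

End HomotopyFull.

(* Main.v *)
Require Import Defs.

(** Let [(U', V', u', p1', p2', e')] be a diagram over [f, g], and let [PI] be the path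
    object that occurs in its homotopy pullback.  The arrow [u'] factors as a weak
    equivalence [w : U' ~> Q], with [Q = U' ×_I PI], followed by a fibration [Q ~> I],
    and the homotopy pullback condition says exactly that [V'] is weakly equivalent to
    the strict pullback [W = Q ×_I A], by some [m : V' ~> W].  A homotopy section [n]
    of [m] gives [e' ∘ n : W ~> B], which lies over the projection [W ~> A] up to
    homotopy; since [g] is a fibration it can be moved along that homotopy to an arrow
    [e''] that lies strictly over it.  Now the weak dependent product applies to [Q],
    [W], [e''] and yields [Q ~> U]; composing with [w] gives [h : U' ~> U] with
    [u ∘ h = u'].  The pullback [P] of [h] and [p1] is [U' ×_I A], it maps to [W]
    by [w × A], and following this arrow with [n] gives the required [P ~> V'].

    The homotopical input is small.
    - [weq_homotopy_epi]: two arrows that agree after precomposition with a weak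
      equivalence are homotopic.  Every homotopy below comes from it: symmetry,
      transitivity, congruence, the passage from fibrewise to plain homotopy, and
      the homotopy section of a weak equivalence.
    - [path_lifting]: for a fibration [u : U ~> I], paths in [U] map to pairs of a
      point of [U] and a path of [I] starting below it by an acyclic fibration.  It
      gives transport along homotopies, and also shows that a strict pullback along
      a fibration is a homotopy pullback. *)

Set Implicit Arguments.
Unset Strict Implicit.
Unset Printing Implicit Defensive.

(** * Equational reasoning with composites *)

Section Composites.
Variable C : category.

Lemma rewrite_head2 (X Y Z : C) (a : Y ~> Z) (b : X ~> Y) (c : X ~> Z) :
  a ∘ b = c -> forall (D : C) (x : D ~> X), a ∘ (b ∘ x) = c ∘ x.
Proof. intros E D x. rewrite comp_assoc, E. reflexivity. Qed.

Lemma rewrite_head3 (X Y Z W : C) (a : Z ~> W) (b : Y ~> Z) (c : X ~> Y) (d : X ~> W) :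
  a ∘ (b ∘ c) = d -> forall (D : C) (x : D ~> X), a ∘ (b ∘ (c ∘ x)) = d ∘ x.
Proof. intros E D x. rewrite <- E, <- !comp_assoc. reflexivity. Qed.

End Composites.

(** Composites are kept associated to the right, where a factor of two or three arrows
    occurs either as the end of a composite or as the head of a tail; these are
    the forms tried here. *)
Ltac crw E :=
  let H := fresh in
  pose proof E as H; repeat rewrite <- comp_assoc in H;
  repeat rewrite <- comp_assoc;
  first [ rewrite H | rewrite (rewrite_head3 H) | rewrite (rewrite_head2 H) ];
  clear H;
  repeat rewrite comp_idl; repeat rewrite comp_idr; repeat rewrite <- comp_assoc.

Ltac cdone := repeat rewrite comp_idl; repeat rewrite comp_idr;
  repeat rewrite <- comp_assoc; solve [reflexivity | assumption | symmetry; assumption].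

(** * Products and pullbacks *)

Section Limits.
Variable C : category.

Lemma pullback_lift (X Y Z P : C) (f : X ~> Z) (g : Y ~> Z) (p1 : P ~> X) (p2 : P ~> Y) :
  is_pullback f g p1 p2 -> forall (Q : C) (a : Q ~> X) (b : Q ~> Y), f ∘ a = g ∘ b ->
  exists m : Q ~> P, p1 ∘ m = a /\ p2 ∘ m = b.
Proof.
  intros [_ H] Q a b E. destruct (H Q a b E) as [m [Hm _]]. exists m; exact Hm.
Qed.

Lemma pullback_ext (X Y Z P : C) (f : X ~> Z) (g : Y ~> Z) (p1 : P ~> X) (p2 : P ~> Y) :
  is_pullback f g p1 p2 -> forall (Q : C) (m n : Q ~> P),
  p1 ∘ m = p1 ∘ n -> p2 ∘ m = p2 ∘ n -> m = n.
Proof.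
  intros [Hc H] Q m n E1 E2.
  destruct (H Q (p1 ∘ n) (p2 ∘ n)) as [l [_ Hl]].
  - rewrite !comp_assoc, Hc. reflexivity.
  - transitivity l; [symmetry|]; apply Hl; auto.
Qed.

Lemma pullback_intro (X Y Z P : C) (f : X ~> Z) (g : Y ~> Z) (p1 : P ~> X) (p2 : P ~> Y) :
  f ∘ p1 = g ∘ p2 ->
  (forall (Q : C) (a : Q ~> X) (b : Q ~> Y), f ∘ a = g ∘ b ->
    exists m : Q ~> P, p1 ∘ m = a /\ p2 ∘ m = b) ->
  (forall (Q : C) (m n : Q ~> P), p1 ∘ m = p1 ∘ n -> p2 ∘ m = p2 ∘ n -> m = n) ->
  is_pullback f g p1 p2.
Proof.
  intros Hc Hl He. split; [exact Hc|]. intros Q a b E.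
  destruct (Hl Q a b E) as [m [H1 H2]]. exists m. split; [auto|].
  intros n [N1 N2]. apply He; congruence.
Qed.

Lemma pullback_sym (X Y Z P : C) (f : X ~> Z) (g : Y ~> Z) (p1 : P ~> X) (p2 : P ~> Y) :
  is_pullback f g p1 p2 -> is_pullback g f p2 p1.
Proof.
  intros H. apply pullback_intro.
  - symmetry; apply H.
  - intros Q a b E. destruct (pullback_lift H (eq_sym E)) as [m [H1 H2]]. exists m; auto.
  - intros Q m n E1 E2. exact (pullback_ext H E2 E1).
Qed.

Lemma product_lift (X Y P : C) (p1 : P ~> X) (p2 : P ~> Y) :
  is_product p1 p2 -> forall (Q : C) (a : Q ~> X) (b : Q ~> Y),
  exists m : Q ~> P, p1 ∘ m = a /\ p2 ∘ m = b.
Proof. intros H Q a b. destruct (H Q a b) as [m [Hm _]]. exists m; exact Hm. Qed.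

Lemma product_ext (X Y P : C) (p1 : P ~> X) (p2 : P ~> Y) :
  is_product p1 p2 -> forall (Q : C) (m n : Q ~> P),
  p1 ∘ m = p1 ∘ n -> p2 ∘ m = p2 ∘ n -> m = n.
Proof.
  intros H Q m n E1 E2. destruct (H Q (p1 ∘ n) (p2 ∘ n)) as [l [_ Hl]].
  transitivity l; [symmetry|]; apply Hl; auto.
Qed.

Lemma terminal_ext (T X : C) (a b : X ~> T) : is_terminal T -> a = b.
Proof. intros H. destruct (H X) as [c [_ Hc]]. rewrite <- (Hc a I). apply Hc, I. Qed.

Lemma product_pullback_terminal (T X Y P : C) (x : X ~> T) (y : Y ~> T)
    (p1 : P ~> X) (p2 : P ~> Y) :
  is_terminal T -> is_product p1 p2 <-> is_pullback x y p1 p2.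
Proof.
  intros HT. split.
  - intros H. split; [apply terminal_ext, HT|]. intros Q a b _. apply H.
  - intros [_ H] Q a b. apply H, terminal_ext, HT.
Qed.

End Limits.

Section PathCategory.
Variable C : path_category.

(** * Weak equivalences and fibrations *)

(** The weak equivalence [r : X ~> PX] of a path object is [r ∘ id] and [id ∘ r],
    to which 2-out-of-6 applies. *)
Lemma weq_idm (X : C) : weq (idm X).
Proof.
  destruct (has_path_object X) as (P & s & t & K & k1 & k2 & r & p & _ & [Hr _] & _).
  apply (weq_2of6 (f := idm X) (g := r) (h := idm P));
    rewrite ?comp_idl, ?comp_idr; exact Hr.
Qed.

Lemma weq_cancel_r (X Y Z : C) (f : X ~> Y) (g : Y ~> Z) :
  weq f -> weq (g ∘ f) -> weq g.
Proof.
  intros Hf Hgf. apply (weq_2of6 (f := idm X) (g := f) (h := g)); [|exact Hgf].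
  rewrite comp_idr; exact Hf.
Qed.

Lemma weq_cancel_l (X Y Z : C) (f : X ~> Y) (g : Y ~> Z) :
  weq g -> weq (g ∘ f) -> weq f.
Proof.
  intros Hg Hgf. apply (weq_2of6 (f := f) (g := g) (h := idm Z)); [exact Hgf|].
  rewrite comp_idl; exact Hg.
Qed.

Lemma weq_retraction (X Y : C) (i : X ~> Y) (r : Y ~> X) :
  r ∘ i = idm X -> weq i -> weq r.
Proof. intros E Hi. apply (weq_cancel_r Hi). rewrite E. apply weq_idm. Qed.

Lemma weq_section (X Y : C) (i : X ~> Y) (r : Y ~> X) :
  r ∘ i = idm X -> weq r -> weq i.
Proof. intros E Hr. apply (weq_cancel_l Hr). rewrite E. apply weq_idm. Qed.

Lemma product_fib_l (X Y P : C) (p1 : P ~> X) (p2 : P ~> Y) :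
  is_product p1 p2 -> fib p1.
Proof.
  intros H. destruct (has_terminal C) as [T HT].
  destruct (HT X) as [x _], (HT Y) as [y _].
  apply (product_pullback_terminal x y p1 p2 HT), pullback_sym in H.
  exact (fib_pullback H (fib_terminal y HT)).
Qed.

Lemma product_fib_r (X Y P : C) (p1 : P ~> X) (p2 : P ~> Y) :
  is_product p1 p2 -> fib p2.
Proof.
  intros H. destruct (has_terminal C) as [T HT].
  destruct (HT X) as [x _], (HT Y) as [y _].
  apply (product_pullback_terminal x y p1 p2 HT) in H.
  exact (fib_pullback H (fib_terminal x HT)).
Qed.

Lemma has_product (X Y : C) :
  exists (P : C) (p1 : P ~> X) (p2 : P ~> Y), is_product p1 p2.
Proof.
  destruct (has_terminal C) as [T HT]. destruct (HT X) as [x _], (HT Y) as [y _].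
  destruct (has_pullback y (fib_terminal x HT)) as (P & p1 & p2 & H).
  exists P, p1, p2. exact (proj2 (product_pullback_terminal x y p1 p2 HT) H).
Qed.

(** * Path objects and factorisations *)

Lemma path_object_refl (X P : C) (s t : P ~> X) :
  is_path_object s t ->
  afib s /\ exists r : X ~> P, weq r /\ s ∘ r = idm X /\ t ∘ r = idm X.
Proof.
  intros (K & k1 & k2 & r & p & HK & (Hr & Hp & E1 & E2) & <- & <-).
  rewrite comp_assoc in E1, E2. split; [split|].
  - exact (fib_comp (product_fib_l HK) Hp).
  - exact (weq_retraction E1 Hr).
  - exists r; auto.
Qed.

(** [⟨q1, t ∘ q2⟩ : Q ~> X × I] is a pullback of the fibration [PI ~> I × I] along
    [f × I], and the projection [X × I ~> I] is a fibration. *)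
Lemma mapping_path_fib (X I P Q : C) (f : X ~> I) (s t : P ~> I)
    (q1 : Q ~> X) (q2 : Q ~> P) :
  is_path_object s t -> is_pullback f s q1 q2 -> fib (t ∘ q2).
Proof.
  intros (K & k1 & k2 & r & p & HK & (_ & Hp & _) & Es & Et) HQ.
  destruct (has_product X I) as (M & x1 & x2 & HM).
  destruct (product_lift HK (f ∘ x1) x2) as (c & Ec1 & Ec2).
  destruct (product_lift HM q1 (t ∘ q2)) as (d & Ed1 & Ed2).
  assert (Hpb : is_pullback p c q2 d).
  { apply pullback_intro.
    - apply (product_ext HK).
      + crw Es. crw Ec1. crw Ed1. symmetry. apply HQ.
      + crw Et. crw Ec2. symmetry. exact Ed2.
    - intros D a b E.
      assert (E1 : f ∘ (x1 ∘ b) = s ∘ a).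
      { rewrite <- Es. crw E. crw Ec1. reflexivity. }
      destruct (pullback_lift HQ E1) as (m & M1 & M2).
      exists m. split; [exact M2|]. apply (product_ext HM).
      + crw Ed1. exact M1.
      + crw Ed2. crw M2. rewrite <- Et. crw E. crw Ec2. reflexivity.
    - intros D m n E1 E2. apply (pullback_ext HQ); [|exact E1].
      rewrite <- Ed1. crw E2. reflexivity. }
  rewrite <- Ed2. exact (fib_comp (product_fib_r HM) (fib_pullback Hpb Hp)).
Qed.

Lemma mapping_path_factorisation (X Y : C) (f : X ~> Y) :
  exists (Z : C) (i : X ~> Z) (p : Z ~> Y) (j : Z ~> X),
    weq i /\ fib p /\ p ∘ i = f /\ j ∘ i = idm X.
Proof.
  destruct (has_path_object Y) as (P & s & t & HP).
  destruct (path_object_refl HP) as (Hs & r & Hr & Esr & Etr).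
  destruct (has_pullback f (proj1 Hs)) as (Z & z2 & z1 & HZ).
  destruct (pullback_lift HZ (a := r ∘ f) (b := idm X)) as (i & Ei2 & Ei1).
  { crw Esr. reflexivity. }
  exists Z, i, (t ∘ z2), z1. repeat split.
  - exact (weq_section Ei1 (proj2 (afib_pullback HZ Hs))).
  - exact (mapping_path_fib HP (pullback_sym HZ)).
  - crw Ei2. crw Etr. reflexivity.
  - exact Ei1.
Qed.

(** * Homotopies *)

(** Let [M] be the object of points of [P] with a path from their image under [a] to
    that under [b].  The constant paths on [a ∘ r = b ∘ r] give an arrow [X ~> M] over
    [P]; replacing it by a fibration over [M] turns the weak equivalence [r] into an
    acyclic fibration over [P] that maps to [M], and its section is the homotopy. *)
Lemma weq_homotopy_epi (X P Y : C) (r : X ~> P) (a b : P ~> Y) :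
  weq r -> a ∘ r = b ∘ r -> homotopic a b.
Proof.
  intros Hr E.
  destruct (has_path_object Y) as (PY & s & t & HP).
  pose proof HP as (K & k1 & k2 & c & p & HK & (_ & Hp & E1 & E2) & Es & Et).
  destruct (product_lift HK a b) as (ab & Ea & Eb).
  destruct (has_pullback ab Hp) as (M & m1 & m2 & HM).
  destruct (pullback_lift HM (a := c ∘ (a ∘ r)) (b := r)) as (d & _ & Ed).
  { apply (product_ext HK).
    - crw E1. crw Ea. reflexivity.
    - crw E2. crw Eb. exact E. }
  destruct (mapping_path_factorisation d) as (Z & i & q & _ & Hi & Hq & Eqi & _).
  destruct (afib_section (f := m2 ∘ q)) as (o & Eo).
  { split.
    - exact (fib_comp (fib_pullback HM Hp) Hq).
    - apply (weq_cancel_r Hi). crw Eqi. crw Ed. exact Hr. }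
  exists PY, s, t, (m1 ∘ (q ∘ o)). split; [exact HP|].
  assert (EM := proj1 HM). split.
  - rewrite <- Es. crw EM. crw Ea. crw Eo. reflexivity.
  - rewrite <- Et. crw EM. crw Eb. crw Eo. reflexivity.
Qed.

Lemma homotopic_refl (D X : C) (d : D ~> X) : homotopic d d.
Proof. exact (weq_homotopy_epi (weq_idm D) eq_refl). Qed.

Lemma homotopic_precomp (E D X : C) (x : E ~> D) (d d' : D ~> X) :
  homotopic d d' -> homotopic (d ∘ x) (d' ∘ x).
Proof.
  intros (P & s & t & H & HP & E1 & E2). exists P, s, t, (H ∘ x).
  split; [exact HP|]. split; rewrite comp_assoc; congruence.
Qed.

Lemma homotopic_sym (D X : C) (d d' : D ~> X) : homotopic d d' -> homotopic d' d.
Proof.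
  intros (P & s & t & H & HP & <- & <-).
  destruct (path_object_refl HP) as (_ & r & Hr & Es & Et).
  apply homotopic_precomp, (weq_homotopy_epi Hr). congruence.
Qed.

Lemma homotopic_postcomp (D X Y : C) (h : X ~> Y) (d d' : D ~> X) :
  homotopic d d' -> homotopic (h ∘ d) (h ∘ d').
Proof.
  intros (P & s & t & H & HP & <- & <-).
  destruct (path_object_refl HP) as (_ & r & Hr & Es & Et).
  rewrite !comp_assoc. apply homotopic_precomp, (weq_homotopy_epi Hr).
  crw Es. crw Et. reflexivity.
Qed.

(** Constant paths give a weak equivalence from [X] to the object of composable
    pairs of paths, on which the two outer end points agree. *)
Lemma homotopic_trans (D X : C) (d d' d'' : D ~> X) :
  homotopic d d' -> homotopic d' d'' -> homotopic d d''.
Proof.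
  intros (P & s & t & H & HP & <- & E) (P' & s' & t' & H' & HP' & E' & <-).
  destruct (path_object_refl HP) as (_ & r & Hr & Es & Et).
  destruct (path_object_refl HP') as (Hs' & r' & Hr' & Es' & Et').
  destruct (has_pullback t (proj1 Hs')) as (M & m' & m & HM).
  destruct (pullback_lift HM (a := H') (b := H)) as (l & <- & <-).
  { congruence. }
  destruct (pullback_lift HM (a := r') (b := r)) as (c & Ec' & Ec).
  { congruence. }
  rewrite !comp_assoc. apply homotopic_precomp, (weq_homotopy_epi (r := c)).
  - apply (weq_cancel_l (g := m)).
    + exact (proj2 (afib_pullback HM Hs')).
    + rewrite Ec. exact Hr.
  - crw Ec. crw Ec'. congruence.
Qed.

Lemma fibrewise_homotopic_homotopic (A B D : C) (g : B ~> A) (d d' : D ~> B) :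
  fibrewise_homotopic g d d' -> homotopic d d'.
Proof.
  intros (P & s & t & H & (K & k1 & k2 & r & p & _ & (Hr & _ & E1 & E2) & <- & <-) & <- & <-).
  apply homotopic_precomp, (weq_homotopy_epi Hr). crw E1. crw E2. reflexivity.
Qed.

(** Factor [m] as an acyclic fibration [p] after a weak equivalence [i] with
    retraction [j].  For a section [o] of [p], [m ∘ (j ∘ o)] is [p ∘ (i ∘ j) ∘ o],
    and [i ∘ j] agrees with the identity after precomposition with [i]. *)
Lemma weq_homotopy_section (X Y : C) (m : X ~> Y) :
  weq m -> exists n : Y ~> X, homotopic (m ∘ n) (idm Y).
Proof.
  intros Hm.
  destruct (mapping_path_factorisation m) as (Z & i & p & j & Hi & Hp & Em & Ej).
  assert (Hw : weq p) by (apply (weq_cancel_r Hi); rewrite Em; exact Hm).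
  destruct (afib_section (conj Hp Hw)) as (o & Eo).
  exists (j ∘ o). rewrite <- Em, <- Eo.
  assert (Hij : homotopic (i ∘ j) (idm Z)).
  { apply (weq_homotopy_epi Hi). crw Ej. reflexivity. }
  apply (homotopic_precomp o), (homotopic_postcomp p) in Hij.
  rewrite comp_idl in Hij. repeat rewrite <- comp_assoc in *. exact Hij.
Qed.

(** * Lifting paths along a fibration *)

(** [Q = U ×_I PI] consists of the points of [U] with a path starting at their image.
    [PU] is a fibrant replacement of [U] over [U ×_I PI ×_I U], by constant paths; so it
    serves as a path object of [U] that maps to [PI].  Taking the initial point
    is a weak equivalence both on [PU] and on [Q], hence so is [a]. *)
Lemma path_lifting (U I PI Q : C) (u : U ~> I) (s t : PI ~> I)
    (q1 : Q ~> U) (q2 : Q ~> PI) (c : I ~> PI) :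
  fib u -> is_path_object s t -> s ∘ c = idm I -> t ∘ c = idm I ->
  is_pullback u s q1 q2 ->
  exists (PU : C) (a : PU ~> Q) (tU : PU ~> U) (r : U ~> PU),
    afib a /\ afib tU /\ u ∘ tU = t ∘ q2 ∘ a /\
    weq r /\ q1 ∘ a ∘ r = idm U /\ q2 ∘ a ∘ r = c ∘ u /\ tU ∘ r = idm U.
Proof.
  intros Hu HP Esc Etc HQ.
  assert (Hs := proj1 (path_object_refl HP)).
  assert (Htq := mapping_path_fib HP HQ).
  destruct (has_pullback (t ∘ q2) Hu) as (N & n2 & n1 & HN).
  destruct (pullback_lift HQ (a := idm U) (b := c ∘ u)) as (l & El1 & El2).
  { crw Esc. reflexivity. }
  destruct (pullback_lift HN (a := idm U) (b := l)) as (d & Ed2 & Ed1).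
  { crw El2. crw Etc. reflexivity. }
  destruct (mapping_path_factorisation d) as (PU & r & p & _ & Hr & Hp & Epr & _).
  assert (Es : q1 ∘ (n1 ∘ p) ∘ r = idm U) by (crw Epr; crw Ed1; exact El1).
  assert (Et : n2 ∘ p ∘ r = idm U) by (crw Epr; exact Ed2).
  exists PU, (n1 ∘ p), (n2 ∘ p), r. repeat split; try assumption.
  - exact (fib_comp (fib_pullback HN Hu) Hp).
  - apply (weq_cancel_l (g := q1)).
    + exact (proj2 (afib_pullback (pullback_sym HQ) Hs)).
    + exact (weq_retraction Es Hr).
  - exact (fib_comp (fib_pullback (pullback_sym HN) Htq) Hp).
  - exact (weq_retraction Et Hr).
  - crw (proj1 HN). reflexivity.
  - crw Epr. crw Ed1. exact El2.
Qed.

(** The new arrow is the end point of the lifted path. *)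
Lemma homotopy_lifting (A B D : C) (g : B ~> A) (d : D ~> B) (x : D ~> A) :
  fib g -> homotopic (g ∘ d) x -> exists d' : D ~> B, g ∘ d' = x /\ homotopic d d'.
Proof.
  intros Hg (P & s & t & H & HP & E1 & E2).
  destruct (path_object_refl HP) as (_ & c & _ & Esc & Etc).
  destruct (has_pullback s Hg) as (Q & q1 & q2 & HQ).
  destruct (path_lifting Hg HP Esc Etc HQ)
    as (PB & a & tB & r & Ha & _ & Eg & Hr & Er1 & _ & Er2).
  destruct (pullback_lift HQ (eq_sym E1)) as (l & El1 & El2).
  destruct (afib_section Ha) as (o & Eo).
  exists (tB ∘ (o ∘ l)). split.
  - crw Eg. crw Eo. crw El2. exact E2.
  - assert (Ed : d = q1 ∘ a ∘ (o ∘ l)) by (crw Eo; symmetry; exact El1).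
    rewrite Ed. apply homotopic_precomp, (weq_homotopy_epi Hr). congruence.
Qed.

(** Let [PU] be as in [path_lifting] and [Z = PU ×_I A], formed with the end points of
    the paths.  Then [m : V ~> U ×_I PI ×_I A] is the inclusion [V ~> Z] of
    constant paths followed by [Z ~> U ×_I PI ×_I A].  The latter is a pullback of the
    acyclic fibration [PU ~> U ×_I PI], and the former is a section of
    [Z ~> V], a pullback of the acyclic fibration [PU ~> U] of end points. *)
Lemma fib_pullback_homotopy_pullback (U A I V : C) (u : U ~> I) (f : A ~> I)
    (p1 : V ~> U) (p2 : V ~> A) :
  fib u -> is_pullback u f p1 p2 -> is_homotopy_pullback u f p1 p2.
Proof.
  intros Hu HV. assert (EV := proj1 HV).
  destruct (has_path_object I) as (P & s & t & HP).
  destruct (path_object_refl HP) as (_ & c & _ & Esc & Etc).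
  destruct (has_pullback s Hu) as (Q & q1 & q2 & HQ).
  destruct (has_pullback f (mapping_path_fib HP HQ)) as (W & w1 & w2 & HW).
  destruct (path_lifting Hu HP Esc Etc HQ)
    as (PU & a & tU & r & Ha & HtU & Eu & Hr & Er1 & Er2 & Er).
  destruct (pullback_lift HW (a := a ∘ (r ∘ p1)) (b := p2)) as (m & Em1 & Em2).
  { crw Er2. crw Etc. exact EV. }
  exists P, s, t, (c ∘ (u ∘ p1)). split; [exact HP|]. split.
  { split; [crw Esc|crw Etc]; cdone. }
  exists Q, q1, q2, W, w1, w2, m. repeat split; try apply HQ; try apply HW; try exact Em2.
  - crw Em1. crw Er1. reflexivity.
  - crw Em1. crw Er2. reflexivity.
  - destruct (has_pullback w1 (proj1 Ha)) as (Z & z1 & z2 & HZ).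
    assert (EZ := proj1 HZ). assert (EW := proj1 HW).
    destruct (pullback_lift HV (a := tU ∘ z1) (b := w2 ∘ z2)) as (v & Ev1 & Ev2).
    { crw Eu. crw EZ. crw EW. reflexivity. }
    assert (Hpb : is_pullback tU p1 z1 v).
    { apply pullback_intro.
      - symmetry; exact Ev1.
      - intros D x y E.
        destruct (pullback_lift HW (a := a ∘ x) (b := p2 ∘ y)) as (b & Eb1 & Eb2).
        { repeat rewrite <- comp_assoc. rewrite (comp_assoc q2), (comp_assoc t).
          rewrite (comp_assoc t q2 a), <- Eu. crw E. crw EV. reflexivity. }
        destruct (pullback_lift HZ (eq_sym Eb1)) as (z & Ez1 & Ez2).
        exists z. split; [exact Ez1|]. apply (pullback_ext HV).
        + crw Ev1. crw Ez1. exact E.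
        + crw Ev2. crw Ez2. exact Eb2.
      - intros D x y E1 E2. apply (pullback_ext HZ); [exact E1|].
        apply (pullback_ext HW).
        + crw (eq_sym EZ). crw E1. crw EZ. reflexivity.
        + crw (eq_sym Ev2). crw E2. crw Ev2. reflexivity. }
    destruct (pullback_lift HZ (eq_sym Em1)) as (i & Ei1 & Ei2).
    assert (Ei : v ∘ i = idm V).
    { apply (pullback_ext HV).
      - crw Ev1. crw Ei1. crw Er. reflexivity.
      - crw Ev2. crw Ei2. exact Em2. }
    rewrite <- Ei2. apply weq_comp.
    + exact (proj2 (afib_pullback HZ Ha)).
    + exact (weq_section Ei (proj2 (afib_pullback Hpb HtU))).
Qed.

End PathCategory.

(** * Homotopy fullness *)

Theorem lemma4p9 (C : path_category) (A I B : C) (f : A ~> I) (g : B ~> A)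
    (hf : fib f) (hg : fib g)
    (U V : C) (u : U ~> I) (p1 : V ~> U) (p2 : V ~> A) (e : V ~> B) :
  is_homotopy_weak_dependent_product f g u p1 p2 e ->
  is_homotopy_full f g u p1 p2 e.
Proof.
  intros (Hu & HV & He & Huniv). assert (EV := proj1 HV). split.
  { split; [|split].
    - rewrite He. apply homotopic_refl.
    - rewrite EV. apply homotopic_refl.
    - exact (fib_pullback_homotopy_pullback Hu HV). }
  intros U' V' u' p1' p2' e' (Hge' & _ & (PI & s & t & H & HP & _ &
    (Q & q1 & q2 & W & w1 & w2 & m & HQ & HW & Em1 & _ & Em2 & Hm))).
  destruct (path_object_refl HP) as (_ & c & _ & Esc & Etc).
  destruct (weq_homotopy_section Hm) as (n & Hn).
  (* Move [e' ∘ n] to an arrow [e''] strictly over the projection [w2]. *)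
  destruct (homotopy_lifting (d := e' ∘ n) (x := w2) hg) as (e'' & Ee'' & He'').
  { apply (homotopic_precomp n) in Hge'. rewrite <- comp_assoc in Hge'.
    apply (homotopic_trans Hge').
    apply (homotopic_postcomp w2) in Hn.
    rewrite comp_assoc, Em2, comp_idr in Hn. exact Hn. }
  destruct (Huniv Q W (t ∘ q2) w1 w2 e'' (mapping_path_fib HP HQ) HW Ee'')
    as (k & kA & Ek & EkA1 & EkA2 & HkA).
  apply fibrewise_homotopic_homotopic in HkA.
  (* [w] sends a point of [U'] to the constant path at its image. *)
  destruct (pullback_lift HQ (a := idm U') (b := c ∘ u')) as (w & Ew1 & Ew2).
  { crw Esc. reflexivity. }
  assert (Eh : u ∘ (k ∘ w) = u').
  { crw Ek. crw Ew2. crw Etc. reflexivity. }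
  assert (Hp1 : fib p1) by exact (fib_pullback (pullback_sym HV) hf).
  destruct (has_pullback (k ∘ w) Hp1) as (P & q & r & HPb).
  assert (EP := proj1 HPb).
  (* [j] is [w × A], once [P] is identified with [U' ×_I A]. *)
  destruct (pullback_lift HW (a := w ∘ r) (b := p2 ∘ q)) as (j & Ej1 & Ej2).
  { crw Ew2. crw Etc. crw (eq_sym EV). crw EP. crw Eh. reflexivity. }
  assert (Ej : kA ∘ j = q).
  { apply (pullback_ext HV).
    - crw EkA1. crw Ej1. symmetry. rewrite EP. cdone.
    - crw EkA2. exact Ej2. }
  assert (Hnj : homotopic (m ∘ (n ∘ j)) j).
  { apply (homotopic_precomp j) in Hn. rewrite comp_idl, <- comp_assoc in Hn. exact Hn. }
  exists (k ∘ w), P, q, r, (n ∘ j). split; [|split; [|split; [|split]]].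
  - exact (fib_pullback_homotopy_pullback Hp1 HPb).
  - rewrite Eh. apply homotopic_refl.
  - apply (homotopic_postcomp (q1 ∘ w1)) in Hnj.
    rewrite comp_assoc, Em1 in Hnj. revert Hnj. crw Ej1. crw Ew1. exact (fun x => x).
  - apply (homotopic_postcomp w2) in Hnj.
    rewrite comp_assoc, Em2, Ej2 in Hnj. exact Hnj.
  - rewrite comp_assoc. apply (homotopic_trans (d' := e'' ∘ j)).
    + exact (homotopic_precomp j He'').
    + rewrite <- Ej, comp_assoc. exact (homotopic_precomp j (homotopic_sym HkA)).
Qed.
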